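(* Let $n\ge 3$ be an integer, $1\le x\le n-2$, and $\left\lfloor \frac{n}{n-x+1}\right\rfloor\le k\le x$. Then $$F_n(x,k)=\sum_{i=0}^{k-1}F_{n-i-1}(x-i,k)+\sum_{j=0}^{k}F_{n-k-1}(x-k,j).$$
   Context: For integers $n\ge 0$ and $x,k\ge 0$, $B_n^{x,k}$ denotes the set of binary strings of length $n$ that contain exactly $x$ zeros and in which the longest block of consecutive zeros has length exactly $k$ (the all-ones string, including the empty string for $n=0$, lies in $B_n^{0,0}$). $F_n(x,k)=|B_n^{x,k}|$; in particular $F_n(x,k)=0$ whenever no such string exists (e.g. $x>n$ or $k>x$), and $F_n(x,k)=0$ for $n<0$. *)

(* Defs.v *)
From mathcomp Require Import all_boot.

Set Implicit Arguments.
Unset Strict Implicit.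
Unset Printing Implicit Defensive.

(* Binary strings of length n are n.-tuple bool, with false as the letter 0
   and true as the letter 1. *)

Definition longest_zero_block (s : seq bool) : nat :=
  \max_(m < (size s).+1 | infix (nseq m false) s) m.

Definition B (n x k : nat) : {set n.-tuple bool} :=
  [set s : n.-tuple bool |
    (count_mem false s == x) && (longest_zero_block s == k)].

(* Only lengths n >= 0 are represented; the convention that the count is 0 for
   n < 0 has no counterpart here. *)
Definition F (n x k : nat) : nat := #|B n x k|.

(* Main.v *)
Require Import Defs.
From mathcomp Require Import all_boot.
From mathcomp Require Import zify.

(** Classify the strings by their number [i] of leading zeros.  A string with
    [k.+1] leading zeros has a longest zero block exceeding [k]; every other one
    is [0^i 1 t] with [i <= k], and its longest zero block has length
    [maxn i (longest_zero_block t)].  This equals [k] iff either [i < k] and the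
    longest block of [t] is [k], or [i = k] and the longest block of [t] is at
    most [k]. *)

Lemma infix_nseq_leq (T : eqType) (a : T) (m p : nat) (s : seq T) :
  m <= p -> infix (nseq p a) s -> infix (nseq m a) s.
Proof.
move=> /subnKC <-; rewrite nseqD.
by move=> /infixP [s1 [s2 ->]]; rewrite -catA; apply: infix_infix.
Qed.

(** The maximum is attained, since the empty block always occurs, and every shorter block sits
    inside a block that occurs. *)
Lemma leq_longest_zero_block (m : nat) (s : seq bool) :
  (m <= longest_zero_block s) = infix (nseq m false) s.
Proof.
apply/idP/idP => [|ms]; last first.
  have lt_m : m < (size s).+1 by rewrite ltnS -(size_nseq m false) size_infix.
  exact: (@leq_bigmax_cond _ _ _ (Ordinal lt_m)).
rewrite /longest_zero_block.
have [|p ps ->] := @eq_bigmax_cond _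
    [pred p : 'I_(size s).+1 | infix (nseq p false) s] (@nat_of_ord _).
  by apply/card_gt0P; exists ord0; rewrite inE infix0s.
by move=> /infix_nseq_leq; apply.
Qed.

Lemma prefix_nseq_cat_cons (T : eqType) (a b : T) (m i : nat) (s : seq T) :
  a != b -> prefix (nseq m a) (nseq i a ++ b :: s) = (m <= i).
Proof.
move=> /negbTE ab; elim: i m => [|i IHi] [|m] //=; first by rewrite ab.
by rewrite eqxx IHi.
Qed.

(** A block of [a] cannot cross the letter [b], so it lies in the leading run or in [s]. *)
Lemma infix_nseq_cat_cons (T : eqType) (a b : T) (m i : nat) (s : seq T) :
  a != b ->
  infix (nseq m a) (nseq i a ++ b :: s) = (m <= i) || infix (nseq m a) s.
Proof.
move=> ab; elim: i => [|i IHi].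
  by rewrite cat0s infix_consl (prefix_nseq_cat_cons _ _ _ _ 0).
rewrite [nseq i.+1 a ++ _]cat_cons infix_consl IHi (prefix_nseq_cat_cons _ _ _ _ i.+1) // orbA.
(* The bound [m <= i.+1] absorbs [m <= i]. *)
by congr (_ || _); lia.
Qed.

Lemma longest_zero_block_cat (i : nat) (s : seq bool) :
  longest_zero_block (nseq i false ++ true :: s)
  = maxn i (longest_zero_block s).
Proof.
have eqm m : (m <= longest_zero_block (nseq i false ++ true :: s))
           = (m <= maxn i (longest_zero_block s)).
  by rewrite leq_max !leq_longest_zero_block infix_nseq_cat_cons.
(* Two numbers with the same lower bounds are equal. *)
by apply/eqP; rewrite eqn_leq -eqm leqnn eqm leqnn.
Qed.

Lemma card_tuple_bool_cons (n : nat) (P : pred (seq bool)) :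
  #|[set t : n.+1.-tuple bool | P t]|
  = #|[set t : n.-tuple bool | P (true :: t)]|
    + #|[set t : n.-tuple bool | P (false :: t)]|.
Proof.
pose c b (t : n.-tuple bool) := [tuple of b :: t].
have c_inj b : injective (c b) by move=> t u /(congr1 val) [] /val_inj.
rewrite -(card_imset _ (c_inj true)) -(card_imset _ (c_inj false)) -cardsUI.
(* The two images are disjoint because their first letters differ. *)
rewrite [X in _ = _ + X]eq_card0 ?addn0 => [|t]; last first.
  rewrite !inE; apply/negP => /andP [].
  by move=> /imsetP [u _ ->] /imsetP [v _] /(congr1 val).
apply: eq_card => t; rewrite !inE; apply/idP/orP.
  case/tupleP: t => -[] t Pt; [left | right]; apply/imsetP;
    by exists t; rewrite ?inE //; apply: val_inj.
by case=> /imsetP [u]; rewrite inE => Pu ->.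
Qed.

(** The first letter is split off [m] times, each time continuing only in the branch [false]. *)
Lemma card_tuple_bool_leading_zeros (m n : nat) (P : pred (seq bool)) :
  m <= n ->
  #|[set t : n.-tuple bool | P t]|
  = \sum_(0 <= i < m)
      #|[set t : (n - i - 1).-tuple bool | P (nseq i false ++ true :: t)]|
    + #|[set t : (n - m).-tuple bool | P (nseq m false ++ t)]|.
Proof.
elim: m n P => [|m IHm] n P; first by rewrite big_geq ?subn0.
case: n => // n lt_mn.
rewrite card_tuple_bool_cons big_nat_recl //= -addnA; congr (_ + _).
  by rewrite subn0 subn1.
by rewrite (IHm n (fun t => P (false :: t))).
Qed.

Lemma sum_F (n x k : nat) :
  \sum_(0 <= j < k) F n x j
  = #|[set t : n.-tuple bool |
        (count_mem false t == x) && (longest_zero_block t < k)]|.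
Proof.
elim: k => [|k IHk].
  by rewrite big_geq // eq_card0 // => t; rewrite !inE ltn0 andbF.
rewrite big_nat_recr //= IHk -cardsUI.
rewrite [X in _ + X]eq_card0 ?addn0 => [|t]; last by rewrite !inE; lia.
by apply: eq_card => t; rewrite !inE -andb_orr; congr (_ && _); lia.
Qed.

Theorem theorem3p2 (n x k : nat)
    (hn : 3 <= n) (hx1 : 1 <= x) (hx2 : x <= n - 2)
    (hk1 : n %/ (n - x + 1) <= k) (hk2 : k <= x) :
  F n x k = \sum_(0 <= i < k) F (n - i - 1) (x - i) k
            + \sum_(0 <= j < k.+1) F (n - k - 1) (x - k) j.
Proof.
have lt_kn : k < n by lia.
(* Cutting at [k.+1], which [lt_kn] permits, keeps the case [i = k] in the sum and leaves a
   remainder that is empty. *)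
rewrite sum_F /F /B (card_tuple_bool_leading_zeros k.+1 n
  (fun t => (count_mem false t == x) && (longest_zero_block t == k))) //.
rewrite [X in _ + X]eq_card0 => [|t]; last first.
  rewrite !inE; apply/negP => /andP [_ /eqP eq_k].
  suff: k.+1 <= k by rewrite ltnn.
  by rewrite -{2}eq_k leq_longest_zero_block; apply/prefixW/prefix_prefix.
rewrite addn0 big_nat_recr //=; congr (_ + _); last first.
  apply: eq_card => t; rewrite !inE longest_zero_block_cat.
  rewrite count_cat count_nseq /=; lia.
(* The range [i < k] is kept: with [k <= x] it makes [x - i] a true difference, and it forces the
   maximum [k] to come from [t]. *)
rewrite !big_nat; apply: eq_bigr => i lt_ik; apply: eq_card => t.
rewrite !inE longest_zero_block_cat count_cat count_nseq /=; lia.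
Qed.
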